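(* Let $V:f=0$ be a reduced plane curve of degree $d$ in $\mathbb{P}^2$, where $f\in\mathbb{C}[x,y,z]$ is homogeneous of degree $d$, essentially involves the three variables, and has Waring rank $5$. Suppose that $f=\ell_1^d+\cdots+\ell_5^d$ is a Waring decomposition $(\mathcal{D})$ of $f$ such that the associated line arrangement $\mathcal{A}_{\mathcal{D}}:\ell_1\cdots\ell_5=0$ has $n_3=2$ triple points (and $n_2=4$ double points). Then, up to a linear change of coordinates, $$f=x^d+y^d+z^d+(a_1x+b_1y)^d+(a_2x+b_2z)^d$$ with $(a_1,b_1,a_2,b_2)\in(\mathbb{C}^* )^4$, and the curve $V$ is either smooth, or it has only nodes $A_1$ as singularities.
   Context: The Waring rank of a homogeneous polynomial $f$ of degree $d$ over $\mathbb{C}$ is the minimal $r$ such that $f=\ell_1^d+\cdots+\ell_r^d$ with linear forms $\ell_j$; such an expression with $r$ minimal is called a Waring decomposition. The form $f$ essentially involves the variables $x,y,z$ if it cannot be written, after a linear change of coordinates, as a polynomial in fewer than three variables; equivalently the $\ell_j$ span the space of all linear forms. For a line arrangement, $n_j$ is the number of points lying on exactly $j$ lines of the arrangement. *)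

(* Defs.v *)
From mathcomp Require Import all_boot all_order all_algebra.
From mathcomp Require Import reals.
From mathcomp.real_closed Require Import complex.
From mathcomp Require Import mpoly.

Set Implicit Arguments.
Unset Strict Implicit.
Unset Printing Implicit Defensive.

Import GRing.Theory.
Local Open Scope ring_scope.

(* Since d.-homog contains 0, vanishing forms are allowed here; they never
   occur in an expression of minimal length when d > 0. *)
Definition power_sum (C : fieldType) (n d r : nat)
    (l : 'I_r -> {mpoly C[n]}) (f : {mpoly C[n]}) : Prop :=
  (forall i, l i \is 1.-homog) /\ f = \sum_(i < r) l i ^+ d.

Definition has_waring_rank (C : fieldType) (n d r : nat)
    (f : {mpoly C[n]}) : Prop :=
  (exists l : 'I_r -> {mpoly C[n]}, power_sum d l f) /\
  (forall (s : nat) (l : 'I_s -> {mpoly C[n]}), power_sum d l f -> (r <= s)%N).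

Definition waring_decomposition (C : fieldType) (n d r : nat)
    (l : 'I_r -> {mpoly C[n]}) (f : {mpoly C[n]}) : Prop :=
  has_waring_rank d r f /\ power_sum d l f.

(* f(A X): the variable X_i is replaced by the i-th entry of A X. *)
Definition lin_subst (C : fieldType) (n : nat) (A : 'M[C]_n)
    (f : {mpoly C[n]}) : {mpoly C[n]} :=
  f \mPo [tuple \sum_(j < n) A i j *: 'X_j | i < n].

Definition essentially_involves_all (C : fieldType) (n : nat)
    (f : {mpoly C[n]}) : Prop :=
  ~ exists (k : nat) (ltkn : (k < n)%N) (A : 'M[C]_n) (g : {mpoly C[k]}),
      A \in unitmx /\
      lin_subst A f = g \mPo [tuple 'X_(widen_ord (ltnW ltkn) i) | i < k].

(* The curve f = 0 is reduced: f has no multiple factor (in particular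
   f != 0, as 0 is divisible by 'X_0 ^+ 2). *)
Definition reduced (C : fieldType) (f : {mpoly C[3]}) : Prop :=
  forall g h : {mpoly C[3]}, f = g ^+ 2 * h -> g \is a GRing.unit.

Definition P2 (C : fieldType) := {U : {vspace 'cV[C]_3} | \dim U == 1%N}.

(* For f homogeneous this does not depend on the representative vpick. *)
Definition vanishes_at (C : fieldType) (f : {mpoly C[3]}) (p : P2 C) : bool :=
  f.@[fun i => vpick (val p) i 0] == 0.

(* Lines are counted through their indices: this is the number of lines of the
   arrangement through p when the forms l i are pairwise non-proportional,
   which holds for the forms of a Waring decomposition of degree d > 0. *)
Definition point_mult (C : fieldType) (r : nat) (l : 'I_r -> {mpoly C[3]})
    (p : P2 C) : nat :=
  #|[set i : 'I_r | vanishes_at (l i) p]|.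

Definition num_points (C : fieldType) (r : nat) (l : 'I_r -> {mpoly C[3]})
    (j n : nat) : Prop :=
  exists s : seq (P2 C),
    [/\ uniq s, size s = n & forall p, (p \in s) = (point_mult l p == j)].

Definition singular_point (C : fieldType) (f : {mpoly C[3]}) (p : P2 C) : Prop :=
  vanishes_at f p /\ forall i : 'I_3, vanishes_at f^`M(i) p.

Definition smooth (C : fieldType) (f : {mpoly C[3]}) : Prop :=
  forall p : P2 C, ~ singular_point f p.

(* Equation f(A (u, v, 1)) of the curve f = 0 in the affine chart given by the
   coordinates A; its origin is the point spanned by the last column of A. *)
Definition local_equation (C : fieldType) (A : 'M[C]_3) (f : {mpoly C[3]}) :
    {mpoly C[2]} :=
  f \mPo [tuple A i 0 *: 'X_0 + A i 1 *: 'X_1 + (A i 2)%:MP | i < 3].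

(* A node A_1, i.e. an ordinary double point: the multiplicity is 2 and the
   tangent cone is a pair of distinct lines. *)
Definition node (C : fieldType) (f : {mpoly C[3]}) (p : P2 C) : Prop :=
  exists2 A : 'M[C]_3, A \in unitmx /\ col 2 A \in val p &
    let g := local_equation A f in
    [/\ pihomog mdeg 0 g = 0, pihomog mdeg 1 g = 0 &
        exists m1 m2 : {mpoly C[2]},
          [/\ m1 \is 1.-homog, m2 \is 1.-homog,
              (forall a b : C, a *: m1 + b *: m2 = 0 -> a = 0 /\ b = 0) &
              pihomog mdeg 2 g = m1 * m2]].

Definition only_nodes (C : fieldType) (f : {mpoly C[3]}) : Prop :=
  forall p : P2 C, singular_point f p -> node f p.

Definition normal_form (C : fieldType) (d : nat) (a1 b1 a2 b2 : C) :
    {mpoly C[3]} :=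
  let x := 'X_0 in let y := 'X_1 in let z := 'X_2 in
  x ^+ d + y ^+ d + z ^+ d
  + (a1 *: x + b1 *: y) ^+ d + (a2 *: x + b2 *: z) ^+ d.

(* Main.v *)
Require Import Defs.
From mathcomp Require Import all_boot all_order all_algebra.
From mathcomp Require Import reals.
From mathcomp.real_closed Require Import complex.
From mathcomp Require Import mpoly.
From HB Require Import structures.
From mathcomp Require Import ring.
Import GRing.Theory Num.Theory.
Local Open Scope ring_scope.

Set Implicit Arguments.
Unset Strict Implicit.
Unset Printing Implicit Defensive.

(** Why the theorem holds.

Minimality of the decomposition forces the five forms to be pairwise
non-proportional: over an algebraically closed field two proportional d-th
powers add up to a single d-th power ([waring_not_proportional]). Hence two
lines of the arrangement meet in one point only, so the two triple points p
and q lie on exactly one common line. The five lines are then this line, two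
more through p and two more through q ([two_triples]). The forms vanishing at
p make up a plane, and so do those vanishing at q. With x the common line, y a
line through p and z a line through q, the forms x, y, z are coordinates, and
the last two lines are a1 x + b1 y and a2 x + b2 z. Their coefficients are
nonzero by non-proportionality ([normal_rows_exist]).

For the singularities, write f = x^d + y^d + z^d + c3^d + c4^d with
c3 = a1 x + b1 y and c4 = a2 x + b2 z. A singular point is a node as soon as
the Hessian of f in two affine coordinates vanishing there is nondegenerate.
No monomial contains both y and z, so away from x = 0 the Hessian in y and z is
diagonal; an entry y^(d-2) + b1^2 c3^(d-2) that vanished together with the
derivative y^(d-1) + b1 c3^(d-1) would give a1 b1 x c3^(d-2) = 0
([second_derivative_neq0]). At a singular point with x = 0, where c3 = b1 y and
c4 = b2 z, the derivative in x gives a1 c3^(d-1) + a2 c4^(d-1) = 0, so neither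
y nor z is zero. The derivative in z, equal to z times the second derivative in
z up to a constant as c4 = b2 z, vanishes; so does this second derivative,
while the mixed one in x and z is a multiple of a2 b2 (b2 z)^(d-2), which is
not zero.

The arguments need d at least 2. For d = 0 the form is constant and involves
no variable; for d = 1 it has rank at most 1. *)

(** * Linear forms as row vectors *)

Lemma sum2 (V : nmodType) (F : 'I_2 -> V) : \sum_i F i = F 0 + F 1.
Proof.
by rewrite !big_ord_recl big_ord0 addr0; congr (_ + F _); apply: val_inj.
Qed.

Lemma sum3 (V : nmodType) (F : 'I_3 -> V) : \sum_i F i = F 0 + F 1 + F 2.
Proof.
rewrite !big_ord_recl big_ord0 addr0 addrA.
by congr (_ + F _ + F _); apply: val_inj.
Qed.

Section LinearForms.
Variable C : fieldType.

Definition linform n (r : 'rV[C]_n) : {mpoly C[n]} := \sum_(j < n) r 0 j *: 'X_j.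

Lemma linform_is_linear n : linear (@linform n).
Proof.
move=> a r s; rewrite /linform scaler_sumr -big_split /=.
by apply: eq_bigr => j _; rewrite !mxE scalerDl scalerA.
Qed.

HB.instance Definition _ n :=
  GRing.isLinear.Build C 'rV[C]_n {mpoly C[n]} _ (@linform n)
    (@linform_is_linear n).

Lemma linform_homog n (r : 'rV[C]_n) : linform r \is 1.-homog.
Proof. by apply: rpred_sum => j _; rewrite rpredZ // dhomogX /= mdeg1. Qed.

Lemma homog1_linform n (g : {mpoly C[n]}) :
  g \is 1.-homog -> exists r, g = linform r.
Proof.
move=> g1; exists (\row_j g@_U_(j)); apply/mpolyP => m.
rewrite /linform raddf_sum /=.
have [/mdeg1P [i /eqP ->]|m1] := boolP (mdeg m == 1%N).
  rewrite (bigD1 i) //= mcoeffZ mcoeffXU eqxx mulr1 mxE big1 ?addr0 // => j ji.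
  by rewrite mcoeffZ mcoeffXU (negbTE ji) mulr0.
rewrite (dhomog_nemf_coeff g1 m1) big1 // => j _.
rewrite mcoeffZ mcoeffX; case: eqP => [e|_]; last by rewrite mulr0.
by rewrite -e mdeg1 in m1.
Qed.

Lemma meval_linform n (r : 'rV[C]_n) (v : 'cV[C]_n) :
  (linform r).@[fun i => v i 0] = (r *m v) 0 0.
Proof.
by rewrite raddf_sum mxE; apply: eq_bigr => j _; rewrite /= mevalZ mevalXU.
Qed.

Lemma mderiv_linform n (r : 'rV[C]_n) j : (linform r)^`M(j) = (r 0 j)%:MP.
Proof.
rewrite raddf_sum (bigD1 j) //= mderivZ mderivX mnm1E eqxx scale1r.
rewrite -[X in (X - _)%MM]add0m addmK mpolyX0 big1 => [|i ij].
  by rewrite addr0 -mul_mpolyC mulr1.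
by rewrite mderivZ mderivX mnm1E (negbTE ij) scale0r scaler0.
Qed.

Lemma lin_subst_linform n (A : 'M[C]_n) (r : 'rV[C]_n) :
  lin_subst A (linform r) = linform (r *m A).
Proof.
rewrite /lin_subst raddf_sum /=.
under eq_bigr do
  rewrite comp_mpolyZ comp_mpolyXU -tnth_nth tnth_mktuple scaler_sumr.
rewrite exchange_big; apply: eq_bigr => j _ /=.
by rewrite mxE scaler_suml; apply: eq_bigr => i _; rewrite scalerA.
Qed.

(** In the chart given by A the form r becomes affine: its constant term is the
value of r at the origin of the chart. *)
Lemma local_equation_linform (A : 'M[C]_3) (r : 'rV[C]_3) :
  local_equation A (linform r)
  = linform (r *m colsub (widen_ord (leqnSn 2)) A) + ((r *m A) 0 2)%:MP.
Proof.
rewrite /local_equation raddf_sum /=.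
under eq_bigr do rewrite comp_mpolyZ comp_mpolyXU -tnth_nth tnth_mktuple.
under eq_bigr do
  rewrite !scalerDr !scalerA -[_ *: (A _ 2)%:MP]mul_mpolyC -mpolyCM.
rewrite !big_split /= -!scaler_suml -raddf_sum /linform sum2 !mxE.
congr (_ *: _ + _ *: _ + _); apply: eq_bigr => i _; rewrite ?mxE;
  by congr (_ * A _ _); apply: val_inj.
Qed.

Lemma mderiv_exp n (i : 'I_n) (g : {mpoly C[n]}) e :
  (g ^+ e.+1)^`M(i) = (g ^+ e * g^`M(i)) *+ e.+1.
Proof.
elim: e => [|e IH]; first by rewrite !expr1 mul1r.
by rewrite exprS mderivM IH mulrnAr mulrA -exprS mulrC [in RHS]mulrS.
Qed.

(** The k-th term of the binomial expansion, the only one of degree k. *)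
Lemma pihomog_affine_pow n (w : 'rV[C]_n) (c : C) k e :
  pihomog mdeg k ((linform w + c%:MP) ^+ (k + e))
  = 'C(k + e, k)%:R * c ^+ e *: linform w ^+ k.
Proof.
have hom m : linform w ^+ m * (c ^+ (k + e - m))%:MP *+ 'C(k + e, m) \is m.-homog.
  rewrite mulrC mul_mpolyC rpredMn // rpredZ //.
  by have := dhomogMn m (linform_homog w); rewrite mul1n.
have ltk : (k < (k + e).+1)%N by rewrite ltnS leq_addr.
rewrite addrC exprDn raddf_sum /= (bigD1 (Ordinal ltk)) //= big1 => [|m mk].
  rewrite addr0 mulrC -rmorphXn pihomog_dE ?hom // addKn.
  by rewrite mulrC mul_mpolyC mulr_natl -scalerMnl.
by rewrite mulrC -rmorphXn (pihomog_ne0 _ (hom m)) // (contraNneq _ mk).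
Qed.

Definition sum_powers (d : nat) (s : seq 'rV[C]_3) : {mpoly C[3]} :=
  \sum_(u <- s) linform u ^+ d.

Lemma lin_subst_sum_powers d (A : 'M[C]_3) s :
  lin_subst A (sum_powers d s) = sum_powers d [seq u *m A | u <- s].
Proof.
rewrite /sum_powers big_map /lin_subst raddf_sum /=; apply: eq_bigr => u _.
by rewrite rmorphXn /= -lin_subst_linform.
Qed.

End LinearForms.

(** * Singular points of sums of powers *)

Section Nodes.
Variable C : numClosedFieldType.

(** The gradient at p is a combination of the coefficient vectors u, with the
values u(p)^d as weights; characteristic zero removes the factor d + 1. *)
Lemma singular_sum_powers d s (p : P2 C) : singular_point (sum_powers d.+1 s) p ->
  \sum_(u <- s) (u *m vpick (val p)) 0 0 ^+ d *: u = 0.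
Proof.
case=> _ sing; apply/rowP => j; rewrite summxE !mxE.
have := sing j.
rewrite /vanishes_at /sum_powers (raddf_sum (mderiv j)) raddf_sum /= => /eqP.
under eq_bigr do rewrite mderiv_exp mderiv_linform raddfMn /= mevalM mevalC
  rmorphXn /= meval_linform.
rewrite sumrMnl => /eqP; rewrite mulrn_eq0 /= => /eqP sum0.
by rewrite -[RHS]sum0; apply: eq_bigr => u _; rewrite mxE.
Qed.

(** The roots come from the quadratic formula, and they are distinct as the
discriminant is nonzero. *)
Lemma binary_quadratic_factor (a b c : C) : b ^+ 2 != a * c ->
  exists m1 m2 : {mpoly C[2]},
    [/\ m1 \is 1.-homog, m2 \is 1.-homog,
        forall s t : C, s *: m1 + t *: m2 = 0 -> s = 0 /\ t = 0 &
        a *: 'X_0 ^+ 2 + (b *+ 2) *: ('X_0 * 'X_1) + c *: 'X_1 ^+ 2 = m1 * m2].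
Proof.
have lin (s : 'I_2 -> C) :
    {m : {mpoly C[2]} | m = s 0 *: 'X_0 + s 1 *: 'X_1 & m \is 1.-homog}.
  exists (linform (\row_j s j)); last exact: linform_homog.
  by rewrite /linform sum2 !mxE.
move=> disc.
suff [m [m' [ndet e0 e1 e2]]] : exists m m' : 'I_2 -> C,
    [/\ m 0 * m' 1 - m 1 * m' 0 != 0, a = m 0 * m' 0,
        b *+ 2 = m 0 * m' 1 + m 1 * m' 0 & c = m 1 * m' 1].
  have [q qE q1] := lin m; have [q' qE' q1'] := lin m'.
  exists q, q'; split=> // [s t|].
    move=> /(congr1 (fun g : {mpoly C[2]} => (g@_U_(0), g@_U_(1)))).
    rewrite qE qE' !(mcoeffD, mcoeffZ, mcoeffXU, mcoeff0) /=.
    rewrite !(mulr0, mulr1, addr0, add0r).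
    case=> e e'; split; apply: (mulIf ndet); rewrite mul0r.
      have -> : s * (m 0 * m' 1 - m 1 * m' 0)
          = (s * m 0 + t * m' 0) * m' 1 - (s * m 1 + t * m' 1) * m' 0 by ring.
      by rewrite e e' !mul0r subr0.
    have -> : t * (m 0 * m' 1 - m 1 * m' 0)
        = (s * m 1 + t * m' 1) * m 0 - (s * m 0 + t * m' 0) * m 1 by ring.
    by rewrite e e' !mul0r subr0.
  rewrite e0 e1 e2 qE qE' -!mul_mpolyC !(mpolyCD, mpolyCM); ring.
(* When a = 0 the factor 'X_1 splits off, as the formula below divides by a. *)
have [a0|a0] := eqVneq a 0.
  exists (fun i => (i == 1)%:R), (fun i => if i == 0 then b *+ 2 else c) => /=.
  split; rewrite ?a0 /=; try ring.
  rewrite !mul0r mul1r sub0r oppr_eq0 mulrn_eq0 /=.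
  by apply: contraNneq disc => ->; rewrite a0 mul0r expr0n.
pose e := sqrtC (b ^+ 2 - a * c).
have eE : e ^+ 2 = b ^+ 2 - a * c by rewrite sqrtCK.
exists (fun i => if i == 0 then a else b - e).
exists (fun i => if i == 0 then 1 else (b + e) / a) => /=.
split; rewrite ?mulr1 //.
- rewrite mulrC divfK // (_ : _ - _ = e *+ 2); last by ring.
  by rewrite mulrn_eq0 /= -sqrf_eq0 eE subr_eq0.
- by rewrite mulrC divfK //; ring.
- by rewrite mulrA -subr_sqr eE opprB addrC subrK mulrAC divff ?mul1r.
Qed.

(** The degree 2 part of the local equation at the origin of the chart A is a
nonzero multiple of the sum of the u(p)^d times the squares of the linear parts
of the u. So h is, up to a scalar, the Hessian there, and the tangent cone
consists of two distinct lines when h is nondegenerate. *)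
Lemma node_sum_powers d s (p : P2 C) (A : 'M[C]_3) :
    A \in unitmx -> col 2 A = vpick (val p) ->
    singular_point (sum_powers d.+2 s) p ->
    (let h i j :=
       \sum_(u <- s) (u *m A) 0 2 ^+ d * ((u *m A) 0 i * (u *m A) 0 j) in
     h 0 1 ^+ 2 != h 0 0 * h 1 1) ->
  node (sum_powers d.+2 s) p.
Proof.
move=> uA cA sing /= disc.
have cE (u : 'rV_3) : (u *m vpick (val p)) 0 0 = (u *m A) 0 2.
  by rewrite -cA !mxE; apply: eq_bigr => i _; rewrite mxE.
pose w (u : 'rV[C]_3) := u *m colsub (widen_ord (leqnSn 2)) A.
have w0 u : w u 0 0 = (u *m A) 0 0.
  rewrite !mxE; apply: eq_bigr => i _; rewrite mxE.
  by congr (_ * A _ _); apply: val_inj.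
have w1 u : w u 0 1 = (u *m A) 0 1.
  rewrite !mxE; apply: eq_bigr => i _; rewrite mxE.
  by congr (_ * A _ _); apply: val_inj.
have gE : local_equation A (sum_powers d.+2 s)
    = \sum_(u <- s) (linform (w u) + ((u *m A) 0 2)%:MP) ^+ d.+2.
  rewrite /sum_powers /local_equation raddf_sum; apply: eq_bigr => u _.
  by rewrite /= rmorphXn /= -local_equation_linform.
exists A; first by rewrite cA memv_pick.
rewrite /= gE !raddf_sum /=; split.
- under eq_bigr do rewrite (pihomog_affine_pow _ _ 0 d.+2) bin0 mul1r expr0 -cE.
  rewrite -scaler_suml; case: sing => /eqP + _.
  rewrite /sum_powers raddf_sum /=.
  under eq_bigr do rewrite rmorphXn /= meval_linform.
  by move=> ->; rewrite scale0r.
- under eq_bigr do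
    rewrite (pihomog_affine_pow _ _ 1 d.+1) bin1 expr1 -cE -scalerA.
  rewrite -scaler_sumr.
  under eq_bigr do rewrite -linearZ scalemxAl.
  rewrite -raddf_sum -mulmx_suml (singular_sum_powers sing) mul0mx.
  by rewrite raddf0 scaler0.
- under eq_bigr do rewrite (pihomog_affine_pow _ _ 2 d) -scalerA.
  rewrite -scaler_sumr.
  have b0 : 'C(d.+2, 2)%:R != 0 :> C by rewrite pnatr_eq0 -lt0n bin_gt0.
  pose h i j := \sum_(u <- s) (u *m A) 0 2 ^+ d * ((u *m A) 0 i * (u *m A) 0 j).
  pose B := 'C(d.+2, 2)%:R : C.
  have [|m1 [m2 [h1 h2 ind e]]] :=
      @binary_quadratic_factor (B * h 0 0) (B * h 0 1) (B * h 1 1).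
    by rewrite exprMn [X in _ != X]mulrACA -expr2 (inj_eq (mulfI _)) ?expf_neq0.
  exists m1, m2; split=> //; rewrite -e.
  rewrite -mulrnAr -!scalerA -!scalerDr; congr (_ *: _).
  rewrite -sumrMnl !scaler_suml -!big_split /=; apply: eq_bigr => u _.
  rewrite /linform sum2 w0 w1 -!mul_mpolyC !(mpolyCMn, mpolyCM).
  ring.
Qed.
End Nodes.

(** * Nodes of the normal form *)

Section Coordinates.
Variable C : fieldType.

Definition row3 (a b c : C) : 'rV[C]_3 := \row_(j < 3) [:: a; b; c]`_j.

Lemma row3E a b c :
  ((row3 a b c 0 0 = a) * (row3 a b c 0 1 = b) * (row3 a b c 0 2 = c))%type.
Proof. by rewrite !mxE. Qed.

Lemma row3P (r : 'rV[C]_3) : r = row3 (r 0 0) (r 0 1) (r 0 2).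
Proof.
apply/rowP; case=> [[|[|[|//]]] lt]; rewrite !mxE /=.
all: by congr (r _ _); apply: val_inj.
Qed.

Lemma linform_row3 a b c :
  linform (row3 a b c) = a *: 'X_0 + b *: 'X_1 + c *: 'X_2 :> {mpoly C[3]}.
Proof. by rewrite /linform sum3 !row3E. Qed.

Lemma row3_mul a b c (v : 'cV[C]_3) :
  (row3 a b c *m v) 0 0 = a * v 0 0 + b * v 1 0 + c * v 2 0.
Proof. by rewrite !mxE sum3 !row3E. Qed.

Definition rows3 (r0 r1 r2 : 'rV[C]_3) : 'M[C]_3 :=
  \matrix_(i < 3) [:: r0; r1; r2]`_i.

Lemma row3_mul_rows3 a b c r0 r1 r2 :
  row3 a b c *m rows3 r0 r1 r2 = a *: r0 + b *: r1 + c *: r2.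
Proof. by rewrite mulmx_sum_row sum3 !row3E !rowK. Qed.

(** The chart centred at z whose affine coordinates are the j-th and k-th
projective coordinates. *)
Definition frame (j k : 'I_3) (z : 'cV[C]_3) : 'M[C]_3 :=
  \matrix_(m, n) [:: (m == j)%:R; (m == k)%:R; z m 0]`_n.

Lemma mul_frame (r : 'rV[C]_3) j k z :
  (((r *m frame j k z) 0 0 = r 0 j) * ((r *m frame j k z) 0 1 = r 0 k)
    * ((r *m frame j k z) 0 2 = (r *m z) 0 0))%type.
Proof.
have dE i : r 0 i = \sum_m r 0 m * (m == i)%:R.
  rewrite (bigD1 i) //= eqxx mulr1 big1 ?addr0 // => m mi.
  by rewrite (negbTE mi) mulr0.
split; first split; rewrite ?dE !mxE; apply: eq_bigr => m _; by rewrite !mxE.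
Qed.

Lemma frame_unit i j k (z : 'cV[C]_3) :
  (forall m, m != i -> m = j \/ m = k) -> z i 0 != 0 -> frame j k z \in unitmx.
Proof.
move=> ijk zi; rewrite -row_free_unit; apply: inj_row_free => r rF.
have E n : (r *m frame j k z) 0 n = 0 by rewrite rF mxE.
have rj : r 0 j = 0 by rewrite -(E 0) mul_frame.
have rk : r 0 k = 0 by rewrite -(E 1) mul_frame.
have rm m : m != i -> r 0 m = 0 by case/ijk => ->.
apply/rowP => m; rewrite mxE; have [->|/rm //] := eqVneq m i.
apply: (mulIf zi); rewrite mul0r -(E 2) mul_frame mxE (bigD1 i) //=.
by rewrite big1 ?addr0 // => n ni; rewrite rm ?mul0r.
Qed.

Definition normal_rows (a1 b1 a2 b2 : C) : seq 'rV[C]_3 :=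
  [:: row3 1 0 0; row3 0 1 0; row3 0 0 1; row3 a1 b1 0; row3 a2 0 b2].

Lemma sum_powers_normal_rows d a1 b1 a2 b2 :
  sum_powers d (normal_rows a1 b1 a2 b2) = normal_form d a1 b1 a2 b2.
Proof.
rewrite /sum_powers /normal_rows /normal_form !big_cons big_nil !linform_row3.
by rewrite !scale1r !scale0r !(addr0, add0r) !addrA.
Qed.

End Coordinates.

(** Up to constants these are the first and second derivatives in w of
w^(d+2) + (a x + b w)^(d+2). If both vanished, Euler's relation would give
a x + b w = 0, then the first derivative w = 0, hence a x = 0. *)
Lemma second_derivative_neq0 (C : fieldType) (a b x w : C) d :
    a != 0 -> b != 0 -> x != 0 -> w ^+ d.+1 + (a * x + b * w) ^+ d.+1 * b = 0 ->
  w ^+ d + (a * x + b * w) ^+ d * (b * b) != 0.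
Proof.
move=> na nb nx e1; apply/negP => /eqP e2.
set c := a * x + b * w in e1 e2.
(* Euler's relation for the derivative in w; the right-hand side is, up to a
   constant, x times the mixed second derivative. *)
have : w ^+ d.+1 + c ^+ d.+1 * b - w * (w ^+ d + c ^+ d * (b * b))
    = b * a * x * c ^+ d by rewrite !exprS /c; ring.
rewrite e1 e2 mulr0 subr0 => /esym/eqP.
rewrite !mulf_eq0 (negbTE na) (negbTE nb) (negbTE nx) expf_eq0 /=.
move=> /andP [_ /eqP c0].
move: e1; rewrite c0 expr0n mul0r addr0 => /eqP; rewrite expf_eq0 /= => /eqP w0.
move: c0; rewrite /c w0 mulr0 addr0 => /eqP.
by rewrite mulf_eq0 (negbTE na) (negbTE nx).
Qed.

(** Let (x, y, t) be the singular point in the coordinates given by L. For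
x <> 0 the Hessian in the second and third coordinates is diagonal. For x = 0
the Hessian in the first and third has a zero on its diagonal, and the mixed
derivative does not vanish. *)
Lemma normal_only_nodes (C : numClosedFieldType) (a1 b1 a2 b2 : C) d
    (L : 'M[C]_3) :
    a1 != 0 -> b1 != 0 -> a2 != 0 -> b2 != 0 -> L \in unitmx ->
  only_nodes (sum_powers d.+2 [seq u *m L | u <- normal_rows a1 b1 a2 b2]).
Proof.
move=> na1 nb1 na2 nb2 uL p sing; set rows := normal_rows a1 b1 a2 b2 in sing *.
set v := vpick (val p).
have nv : v != 0 by rewrite vpick0 -dimv_eq0 (eqP (valP p)).
pose z := L *m v.
have nz : z != 0.
  by apply: contraNneq nv => z0; rewrite -(mulKmx uL v) -/z z0 mulmx0.
set x := z 0 0; set y := z 1 0; set t := z 2 0.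
pose c3 := a1 * x + b1 * y; pose c4 := a2 * x + b2 * t.
have /rowP crit : \sum_(u <- rows) (u *m z) 0 0 ^+ d.+1 *: u = 0.
  apply: (can_inj (mulmxK uL)); rewrite mul0mx -[RHS](singular_sum_powers sing).
  rewrite big_map mulmx_suml; apply: eq_bigr => u _.
  by rewrite -scalemxAl mulmxA.
have E i : \sum_(u <- rows) (u *m z) 0 0 ^+ d.+1 * u 0 i = 0.
  have := crit i; rewrite summxE mxE => ei; rewrite -[RHS]ei.
  by apply: eq_bigr => u _; rewrite [RHS]mxE.
have sumE (F : 'rV[C]_3 -> C -> C) : \sum_(u <- rows) F u ((u *m z) 0 0)
    = F (row3 1 0 0) x + F (row3 0 1 0) y + F (row3 0 0 1) t
      + F (row3 a1 b1 0) c3 + F (row3 a2 0 b2) c4.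
  rewrite /rows !big_cons big_nil !row3_mul !(mul1r, mul0r, addr0, add0r).
  by rewrite !addrA.
have := E 0; rewrite (sumE (fun u c => c ^+ d.+1 * u 0 0)) !row3E.
rewrite !(mulr1, mulr0, addr0) => Ex.
have := E 1; rewrite (sumE (fun u c => c ^+ d.+1 * u 0 1)) !row3E.
rewrite !(mulr1, mulr0, addr0, add0r) => Ey.
have := E 2; rewrite (sumE (fun u c => c ^+ d.+1 * u 0 2)) !row3E.
rewrite !(mulr1, mulr0, addr0, add0r) => Et.
have hessE i i' := sumE (fun u c => c ^+ d * (u 0 i * u 0 i')).
have nodeI j k : frame j k z \in unitmx ->
    (let h i i' := \sum_(u <- rows) (u *m z) 0 0 ^+ d * (u 0 i * u 0 i') in
     h j k ^+ 2 != h j j * h k k) ->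
    node (sum_powers d.+2 [seq u *m L | u <- rows]) p.
  move=> uF /= h; set s := [seq _ | u <- _] in sing *.
  have sumL (F : 'rV[C]_3 -> C) :
    \sum_(u <- s) F u = \sum_(u <- rows) F (u *m L) by rewrite big_map.
  apply: (@node_sum_powers _ _ _ _ (invmx L *m frame j k z)) => //.
  - by rewrite unitmx_mul unitmx_inv uL.
  - have -> : col 2 (invmx L *m frame j k z) = invmx L *m z.
      apply/colP => i; rewrite !mxE; apply: eq_bigr => m _; by rewrite !mxE.
    by rewrite /z mulKmx.
  - cbv beta zeta; rewrite !sumL.
    under eq_bigr do rewrite -!mulmxA (mulKVmx uL) !mul_frame.
    under [X in _ != X * _]eq_bigr do rewrite -!mulmxA (mulKVmx uL) !mul_frame.
    under [X in _ != _ * X]eq_bigr do rewrite -!mulmxA (mulKVmx uL) !mul_frame.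
    exact: h.
have [x0|nx] := eqVneq x 0.
  have c3E : c3 = b1 * y by rewrite /c3 x0 mulr0 add0r.
  have c4E : c4 = b2 * t by rewrite /c4 x0 mulr0 add0r.
  move: Ex; rewrite x0 expr0n add0r => Ex.
  have ny : y != 0.
    apply: contraNneq nz => y0.
    move: Ex; rewrite c3E y0 mulr0 expr0n mul0r add0r => /eqP.
    rewrite mulf_eq0 (negbTE na2) orbF expf_eq0 /= c4E mulf_eq0 (negbTE nb2).
    move=> /eqP t0.
    apply/eqP/colP; case=> [[|[|[|//]]] lt]; rewrite [RHS]mxE.
    - by rewrite -[RHS]x0; congr (z _ _); apply: val_inj.
    - by rewrite -[RHS]y0; congr (z _ _); apply: val_inj.
    - by rewrite -[RHS]t0; congr (z _ _); apply: val_inj.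
  have nt : t != 0.
    apply: contraNneq ny => t0.
    move: Ex; rewrite c4E t0 mulr0 expr0n mul0r addr0 => /eqP.
    by rewrite mulf_eq0 (negbTE na1) orbF expf_eq0 /= c3E mulf_eq0 (negbTE nb1).
  apply: (nodeI 0 2).
    apply: (@frame_unit _ 1) => //; case=> [[|[|[|//]]] lt] // _.
      by left; apply: val_inj.
    by right; apply: val_inj.
  rewrite /= !(hessE 0 2, hessE 0 0, hessE 2 2) !row3E.
  rewrite !(mulr1, mulr0, mul0r, addr0, add0r).
  have -> : t ^+ d + c4 ^+ d * (b2 * b2) = 0.
    apply: (mulIf nt); rewrite mul0r -[RHS]Et !exprS c4E; ring.
  by rewrite mulr0 expf_neq0 // !mulf_neq0 // expf_neq0 // c4E mulf_neq0.
apply: (nodeI 1 2).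
  apply: (@frame_unit _ 0) => //; case=> [[|[|[|//]]] lt] // _.
    by left; apply: val_inj.
  by right; apply: val_inj.
rewrite /= !(hessE 1 2, hessE 1 1, hessE 2 2) !row3E.
rewrite !(mulr1, mulr0, mul0r, addr0, add0r) expr0n eq_sym.
by rewrite mulf_neq0 // (second_derivative_neq0 _ _ nx).
Qed.

(** * The line arrangement *)

Section Points.
Variable C : fieldType.

Lemma P2_span (p : P2 C) : val p = <[vpick (val p)]>%VS.
Proof.
apply/esym/eqP; rewrite eqEdim (eqP (valP p)) dim_vline.
by rewrite vpick0 -dimv_eq0 (eqP (valP p)) /= -memvE memv_pick.
Qed.

Lemma P2_vpick_neq0 (p : P2 C) : vpick (val p) != 0.
Proof. by rewrite vpick0 -dimv_eq0 (eqP (valP p)). Qed.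

Lemma P2_rank2 (p q : P2 C) : p != q ->
  \rank (row_mx (vpick (val p)) (vpick (val q))) = 2%N.
Proof.
move=> pq; rewrite -mxrank_tr tr_row_mx; apply/eqP; apply: inj_row_free => x.
rewrite -[x]hsubmxK mul_row_col (mx11_scalar (lsubmx x)) (mx11_scalar (rsubmx x)).
set a := lsubmx x 0 0; set b := rsubmx x 0 0.
rewrite !mul_scalar_mx -!linearZ -linearD => /(congr1 trmx).
rewrite trmxK trmx0 => ab0.
have b0 : b = 0.
  apply: contraNeq pq => nb; apply/eqP/val_inj/esym/eqP.
  rewrite eqEdim (eqP (valP p)) (eqP (valP q)) leqnn andbT {1}(P2_span q) -memvE.
  suff -> : vpick (val q) = - (a / b) *: vpick (val p).
    by rewrite rpredZ ?memv_pick.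
  apply: (scalerI nb); rewrite scalerA mulrN mulrC divfK // scaleNr.
  by apply/eqP; rewrite -addr_eq0 addrC ab0.
have a0 : a = 0.
  move: ab0 => /eqP; rewrite b0 scale0r addr0 scaler_eq0.
  by rewrite (negbTE (P2_vpick_neq0 p)) orbF => /eqP.
rewrite a0 b0 -[RHS]hsubmxK !linear0.
by congr row_mx; apply/matrixP => i j; rewrite !mxE mul0rn.
Qed.

(** The forms vanishing at both points are the kernel of a matrix of rank 2
with three rows, hence a line. *)
Lemma forms_through_two_points (p q : P2 C) (r s : 'rV[C]_3) : p != q -> r != 0 ->
    r *m vpick (val p) = 0 -> r *m vpick (val q) = 0 ->
    s *m vpick (val p) = 0 -> s *m vpick (val q) = 0 ->
  exists a, s = a *: r.
Proof.
move=> pq nr rp rq sp sq.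
set M := row_mx (vpick (val p)) (vpick (val q)).
have rM : (r <= kermx M)%MS.
  by apply/sub_kermxP; rewrite mul_mx_row rp rq row_mx0.
have sM : (s <= kermx M)%MS.
  by apply/sub_kermxP; rewrite mul_mx_row sp sq row_mx0.
apply/sub_rVP; apply: submx_trans sM _.
by rewrite -(geq_leqif (mxrank_leqif_sup rM)) mxrank_ker P2_rank2 // rank_rV nr.
Qed.

End Points.

(** Since 3 + 3 = 5 + 1, two triples meeting in at most one of five elements
meet in exactly one and cover everything. *)
Lemma two_triples (T : finType) (S1 S2 : {set T}) :
    #|T| = 5%N -> #|S1| = 3%N -> #|S2| = 3%N -> (#|S1 :&: S2| <= 1)%N ->
  exists i0 i1 i2 i3 i4 : T,
    [/\ perm_eq (index_enum T) [:: i0; i1; i2; i3; i4],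
        [/\ i0 \in S1, i1 \in S1, i2 \notin S1, i3 \in S1 & i4 \notin S1] &
        [/\ i0 \in S2, i1 \notin S2, i2 \in S2, i3 \notin S2 & i4 \in S2]].
Proof.
move=> cT c1 c2 cI; have := cardsUI S1 S2; rewrite c1 c2 => cUI.
have cU : (#|S1 :|: S2| <= 5)%N by rewrite -cT max_card.
have cI1 : #|S1 :&: S2| == 1%N.
  rewrite eqn_leq cI lt0n; apply: contraTneq cU => I0.
  by rewrite I0 addn0 in cUI; rewrite cUI.
have UT : S1 :|: S2 = setT.
  apply/eqP; rewrite eqEcard subsetT cardsT cT /=.
  by rewrite -(leq_add2r #|S1 :&: S2|) cUI (eqP cI1).
have /cards2P [i1 [i3 [i13 D1]]] : #|S1 :\: S2| == 2%N.
  by rewrite cardsD c1 (eqP cI1).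
have /cards2P [i2 [i4 [i24 D2]]] : #|S2 :\: S1| == 2%N.
  by rewrite cardsD c2 setIC (eqP cI1).
have /cards1P [i0 I0] := cI1.
have /setIP [i01 i02] : i0 \in S1 :&: S2 by rewrite I0 set11.
have /setDP [i11 i12] : i1 \in S1 :\: S2 by rewrite D1 set21.
have /setDP [i31 i32] : i3 \in S1 :\: S2 by rewrite D1 set22.
have /setDP [i22 i21] : i2 \in S2 :\: S1 by rewrite D2 set21.
have /setDP [i42 i41] : i4 \in S2 :\: S1 by rewrite D2 set22.
have sep (S : {set T}) i j : i \in S -> j \notin S -> i != j.
  by move=> iS jS; apply: contraNneq jS => <-.
exists i0, i1, i2, i3, i4; split=> //.
apply: uniq_perm => [||i]; first exact: index_enum_uniq.
  rewrite /= !inE !negb_or i13 i24 (sep S2 i0 i1) // (sep S1 i0 i2) //.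
  rewrite (sep S2 i0 i3) // (sep S1 i0 i4) // (sep S1 i1 i2) // (sep S1 i1 i4) //.
  by rewrite (sep S2 i2 i3) // (sep S1 i3 i4).
rewrite mem_index_enum; apply/esym.
have : i \in S1 :|: S2 by rewrite UT inE.
have /setP /(_ i) := I0; have /setP /(_ i) := D1; have /setP /(_ i) := D2.
rewrite !inE; case: (i \in S1); case: (i \in S2) => //= e1 e2 e3 _.
- by rewrite -e3.
- by move/esym/orP: e2 => [->|->]; rewrite ?orbT.
- by move/esym/orP: e1 => [->|->]; rewrite ?orbT.
Qed.

(** If l i = a l j then l i ^ d + l j ^ d is the d-th power of a multiple of
l j, so the i-th term can be dropped. The case a = 0 shows that no form
vanishes. *)
Lemma waring_not_proportional (C : numClosedFieldType) n d r
    (l : 'I_r -> {mpoly C[n]}) f (i j : 'I_r) (a : C) :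
    (0 < d)%N -> has_waring_rank d r f -> power_sum d l f -> i != j ->
  l i != a *: l j.
Proof.
case: r l i j => [|r] l i j; first by case: i.
move=> d0 [_ rmin] [l1 fE] ij; apply/eqP => lij.
pose l' k := if lift i k == j then d.-root (1 + a ^+ d) *: l j else l (lift i k).
suff /rmin : power_sum d l' f by rewrite ltnn.
rewrite /l' {l'}; split=> [k|]; first by case: ifP => _; rewrite ?rpredZ.
rewrite fE (bigD1_ord i) //= lij.
have [j0 jE|e] := unliftP i j; last by rewrite e eqxx in ij.
rewrite (bigD1 j0) //= [RHS](bigD1 j0) //= -jE eqxx addrA; congr (_ + _).
  by rewrite !exprZn rootCK // scalerDl scale1r addrC.
by apply: eq_bigr => k kj; rewrite jE (inj_eq lift_inj) (negbTE kj).
Qed.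

Lemma vanishes_linform (C : fieldType) (r : 'rV[C]_3) (p : P2 C) :
  vanishes_at (linform r) p = (r *m vpick (val p) == 0).
Proof.
rewrite /vanishes_at meval_linform; apply/eqP/eqP => [e|->]; last by rewrite mxE.
by rewrite [_ *m _]mx11_scalar e rmorph0.
Qed.

Lemma row3_coord (C : fieldType) (L : 'M[C]_3) (r : 'rV[C]_3) : L \in unitmx ->
  exists a b c, r = row3 a b c *m L.
Proof.
move=> uL; set u := r *m invmx L.
by exists (u 0 0), (u 0 1), (u 0 2); rewrite -row3P mulmxKV.
Qed.

(** Evaluating at v and w separates the coordinates: on a combination of r0,
r1 and r2, the point v only sees the coefficient of r2, and w only that of r1.
This gives both the independence of r0, r1, r2 and the shape of r3 and r4. *)
Lemma normal_rows_exist (C : fieldType) (v w : 'cV[C]_3)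
    (r0 r1 r2 r3 r4 : 'rV[C]_3) :
    r0 != 0 -> (forall a, r3 != a *: r0) -> (forall a, r3 != a *: r1) ->
    (forall a, r4 != a *: r0) -> (forall a, r4 != a *: r2) ->
    [/\ r0 *m v = 0, r1 *m v = 0, r2 *m v != 0, r3 *m v = 0 & r4 *m v != 0] ->
    [/\ r0 *m w = 0, r1 *m w != 0, r2 *m w = 0, r3 *m w != 0 & r4 *m w = 0] ->
  exists (L : 'M[C]_3) (a1 b1 a2 b2 : C),
    [/\ L \in unitmx, [/\ a1 != 0, b1 != 0, a2 != 0 & b2 != 0] &
        [:: r0; r1; r2; r3; r4] = [seq u *m L | u <- normal_rows a1 b1 a2 b2]].
Proof.
move=> n0 r30 r31 r40 r42 [v0 v1 v2 v3 _] [w0 w1 w2 _ w4].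
pose L := rows3 r0 r1 r2.
have Lv a b c : row3 a b c *m L *m v = c *: (r2 *m v).
  by rewrite row3_mul_rows3 !mulmxDl -!scalemxAl v0 v1 !scaler0 !add0r.
have Lw a b c : row3 a b c *m L *m w = b *: (r1 *m w).
  by rewrite row3_mul_rows3 !mulmxDl -!scalemxAl w0 w2 !scaler0 addr0 add0r.
have cz a b c : row3 a b c *m L *m v = 0 -> c = 0.
  by rewrite Lv => /eqP; rewrite scaler_eq0 (negbTE v2) orbF => /eqP.
have bz a b c : row3 a b c *m L *m w = 0 -> b = 0.
  by rewrite Lw => /eqP; rewrite scaler_eq0 (negbTE w1) orbF => /eqP.
have uL : L \in unitmx.
  rewrite -row_free_unit; apply: inj_row_free => u; rewrite [u]row3P.
  move: (u 0 0) (u 0 1) (u 0 2) => a b c e.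
  have c0 : c = 0 by apply: (@cz a b c); rewrite e mul0mx.
  have b0 : b = 0 by apply: (@bz a b c); rewrite e mul0mx.
  move: e; rewrite row3_mul_rows3 c0 b0 !scale0r !addr0 => /eqP.
  rewrite scaler_eq0 (negbTE n0) orbF => /eqP ->.
  by apply/rowP; case=> [[|[|[|//]]] lt]; rewrite !mxE.
have [a1 [b1 [c1 e3]]] := row3_coord r3 uL.
have [a2 [c2 [b2 e4]]] := row3_coord r4 uL.
have c10 : c1 = 0 by apply: (@cz a1 b1 c1); rewrite -e3.
have c20 : c2 = 0 by apply: (@bz a2 c2 b2); rewrite -e4.
exists L, a1, b1, a2, b2; split=> //; last first.
  rewrite /= e3 e4 c10 c20 !row3_mul_rows3.
  by rewrite !(scale1r, scale0r, add0r, addr0).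
have e3' : r3 = a1 *: r0 + b1 *: r1.
  by rewrite e3 row3_mul_rows3 c10 scale0r addr0.
have e4' : r4 = a2 *: r0 + b2 *: r2.
  by rewrite e4 row3_mul_rows3 c20 scale0r addr0.
split.
- by apply: contraNneq (r31 b1) => z; rewrite e3' z scale0r add0r.
- by apply: contraNneq (r30 a1) => z; rewrite e3' z scale0r addr0.
- by apply: contraNneq (r42 b2) => z; rewrite e4' z scale0r add0r.
- by apply: contraNneq (r40 a2) => z; rewrite e4' z scale0r addr0.
Qed.

(** In degree 0 a sum of powers is a constant, and in degree 1 it is a single
linear form. *)
Lemma waring_ge2_degree (C : fieldType) n d r (f : {mpoly C[n.+1]}) :
  (1 < r)%N -> has_waring_rank d r f -> essentially_involves_all f -> (1 < d)%N.
Proof.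
case: d => [|[|//]] r1 [[l [l1 fE]] rmin] ess.
  case: ess; exists 0%N, isT, 1%:M, r%:R; split; first exact: unitmx1.
  rewrite fE; under eq_bigr do rewrite expr0.
  by rewrite sumr_const card_ord /lin_subst !rmorph_nat.
suff /rmin : power_sum 1 (fun _ : 'I_1 => f) f by rewrite leqNgt r1.
split=> [_|]; last by rewrite big_ord1.
by rewrite fE rpred_sum // => i _; rewrite expr1.
Qed.

Lemma two_triple_points (C : numClosedFieldType) d (f : {mpoly C[3]})
    (l : 'I_5 -> {mpoly C[3]}) :
    (1 < d)%N -> has_waring_rank d 5 f -> power_sum d l f -> num_points l 3 2 ->
  (exists (A : 'M[C]_3) (a1 b1 a2 b2 : C),
      A \in unitmx /\
      [/\ a1 != 0, b1 != 0, a2 != 0 & b2 != 0] /\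
      lin_subst A f = normal_form d a1 b1 a2 b2)
  /\ only_nodes f.
Proof.
move=> d1 f_rank l_dec n3; have [l1 fE] := l_dec.
have nprop i j a : i != j -> l i != a *: l j.
  by move=> ij; apply: waring_not_proportional f_rank l_dec ij; apply: ltnW.
have [r rE] := fin_all_exists (fun i => homog1_linform (l1 i)).
have rprop i j a : i != j -> r i != a *: r j.
  by move=> /(@nprop i j a); apply: contraNneq => e; rewrite !rE e linearZ.
have [s [us ss sE]] := n3.
case: s us ss sE => [|p [|q [|//]]] //= /andP [pq _] _ sE.
rewrite inE in pq.
have /esym/eqP cp := sE p; rewrite mem_head in cp.
have /esym/eqP cq := sE q; rewrite !inE eqxx orbT in cq.
have vE i t : vanishes_at (l i) t = (r i *m vpick (val t) == 0).
  by rewrite rE vanishes_linform.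
have cpq :
  (#|[set i | vanishes_at (l i) p] :&: [set i | vanishes_at (l i) q]| <= 1)%N.
  apply/card_le1_eqP => j i; rewrite !in_setI !in_set !vE.
  move=> /andP [/eqP jp /eqP jq] /andP [/eqP ip /eqP iq].
  apply/eqP; apply: contraT => ij.
  have nz : r i != 0 by rewrite -(scale0r (r j)) rprop.
  have [a ja] := forms_through_two_points pq nz ip iq jp jq.
  by have := @rprop j i a; rewrite eq_sym ij ja eqxx => /(_ isT).
have [i0 [i1 [i2 [i3 [i4 [perm Sp Sq]]]]]] :=
  two_triples (card_ord 5) cp cq cpq.
rewrite !in_set !vE in Sp Sq.
have un : uniq [:: i0; i1; i2; i3; i4].
  by rewrite -(perm_uniq perm) index_enum_uniq.
have fr : f = sum_powers d [:: r i0; r i1; r i2; r i3; r i4].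
  by rewrite fE (perm_big _ perm) /sum_powers /= !big_cons !big_nil !rE.
have nz : r i0 != 0.
  rewrite -(scale0r (r i1)) rprop // (contraTneq _ un) // => ->.
  by rewrite /= mem_head.
move: un; rewrite /= !inE !negb_or -!andbA.
move=> /and5P [_ _ n03 n04 /and5P [_ n13 _ _ /and3P [n24 _ _]]].
have [||||||L [a1 [b1 [a2 [b2 [uL nab rows]]]]]] := normal_rows_exist
    (v := vpick (val p)) (w := vpick (val q)) nz
    (r3 := r i3) (r4 := r i4) (r1 := r i1) (r2 := r i2).
- by move=> a; rewrite rprop // eq_sym.
- by move=> a; rewrite rprop // eq_sym.
- by move=> a; rewrite rprop // eq_sym.
- by move=> a; rewrite rprop // eq_sym.
- by case: Sp => /eqP ? /eqP ? ? /eqP ? ?; split.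
- by case: Sq => /eqP ? ? /eqP ? ? /eqP ?; split.
rewrite fr rows; split.
  exists (invmx L), a1, b1, a2, b2; rewrite unitmx_inv; do !split=> //.
  rewrite lin_subst_sum_powers -sum_powers_normal_rows -map_comp.
  by congr sum_powers; apply: map_id_in => u _; rewrite /= mulmxK.
case: nab => na1 nb1 na2 nb2.
by rewrite -(subnK d1) addn2; apply: normal_only_nodes.
Qed.

Theorem proposition5p1 (R : realType) (d : nat) (f : {mpoly R[i][3]})
    (l : 'I_5 -> {mpoly R[i][3]})
    (f_homog : f \is d.-homog)
    (f_reduced : reduced f)
    (f_ess : essentially_involves_all f)
    (f_rank : has_waring_rank d 5 f)
    (f_dec : waring_decomposition d l f)
    (n3 : num_points l 3 2)
    (n2 : num_points l 2 4) :
  (exists (A : 'M[R[i]]_3) (a1 b1 a2 b2 : R[i]),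
      A \in unitmx /\
      [/\ a1 != 0, b1 != 0, a2 != 0 & b2 != 0] /\
      lin_subst A f = normal_form d a1 b1 a2 b2)
  /\ (smooth f \/ only_nodes f).
Proof.
have d1 : (1 < d)%N by apply: waring_ge2_degree f_rank f_ess.
have [nf nodes] := two_triple_points d1 f_rank f_dec.2 n3.
by split=> //; right.
Qed.
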